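(* For each of the following sets $T$ of five generalized patterns there is an integer $k$ such that $|S_n(T)|=0$ for every $n\ge k$. Here $T=Q\cup\{r\}$ with: (1) $Q=\{1\text{-}23,2\text{-}13,3\text{-}21,12\text{-}3\}$, $r\in\{21\text{-}3,2\text{-}31,23\text{-}1,1\text{-}32,13\text{-}2,3\text{-}12,31\text{-}2,32\text{-}1\}$; (2) $Q=\{1\text{-}23,2\text{-}13,3\text{-}21,21\text{-}3\}$, $r\in\{2\text{-}31,23\text{-}1,1\text{-}32,13\text{-}2,3\text{-}12,31\text{-}2\}$; (3) $Q=\{1\text{-}23,2\text{-}13,32\text{-}1,12\text{-}3\}$, $r\in\{21\text{-}3,2\text{-}31,23\text{-}1,1\text{-}32,3\text{-}12,31\text{-}2\}$; (4) $Q=\{1\text{-}23,2\text{-}13,32\text{-}1,21\text{-}3\}$, $r\in\{2\text{-}31,23\text{-}1,1\text{-}32,13\text{-}2,3\text{-}12,31\text{-}2\}$; (5) $Q=\{1\text{-}23,2\text{-}13,3\text{-}21,23\text{-}1\}$, $r\in\{1\text{-}32,13\text{-}2,3\text{-}12,31\text{-}2,32\text{-}1\}$; (6) $Q=\{1\text{-}23,2\text{-}13,32\text{-}1,2\text{-}31\}$, $r\in\{23\text{-}1,1\text{-}32,13\text{-}2,31\text{-}2,3\text{-}12\}$; (7) $Q=\{1\text{-}23,21\text{-}3,3\text{-}21,1\text{-}32\}$, $r\in\{12\text{-}3,32\text{-}1,13\text{-}2,3\text{-}12,31\text{-}2\}$; (8) $Q=\{1\text{-}23,21\text{-}3,32\text{-}1,2\text{-}31\}$,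 $r\in\{3\text{-}12,13\text{-}2,1\text{-}32,23\text{-}1,12\text{-}3\}$; (9) $Q=\{1\text{-}23,23\text{-}1,32\text{-}1,2\text{-}13\}$, $r\in\{1\text{-}32,13\text{-}2,3\text{-}12,31\text{-}2\}$; (10) $Q=\{1\text{-}23,2\text{-}13,3\text{-}21,1\text{-}32\}$, $r\in\{13\text{-}2,3\text{-}12,31\text{-}2\}$; (11) $Q=\{1\text{-}23,23\text{-}1,32\text{-}1,12\text{-}3\}$, $r\in\{1\text{-}32,2\text{-}31,31\text{-}2\}$; (12) $Q=\{1\text{-}23,21\text{-}3,3\text{-}21,31\text{-}2\}$, $r\in\{12\text{-}3,13\text{-}2,3\text{-}12\}$; (13) $Q=\{1\text{-}23,21\text{-}3,3\text{-}21,23\text{-}1\}$, $r\in\{1\text{-}32,13\text{-}2,32\text{-}1\}$; (14) $Q=\{1\text{-}23,21\text{-}3,32\text{-}1,13\text{-}2\}$, $r\in\{3\text{-}21,23\text{-}1,1\text{-}32\}$; (15) $Q=\{1\text{-}23,2\text{-}13,3\text{-}21,13\text{-}2\}$, $r\in\{3\text{-}12,31\text{-}2\}$; (16) $Q=\{1\text{-}23,2\text{-}13,3\text{-}21,2\text{-}31\}$, $r\in\{1\text{-}32,13\text{-}2\}$; (17) $Q=\{1\text{-}23,2\text{-}13,3\text{-}21,32\text{-}1\}$, $r\in\{13\text{-}2,3\text{-}12\}$; (18) $Q=\{1\text{-}23,23\text{-}1,32\text{-}1,1\text{-}32\}$, $r\in\{21\text{-}3,13\text{-}2\}$; (19) $Q=\{1\text{-}23,2\text{-}13,32\text{-}1,13\text{-}2\}$,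 $r\in\{1\text{-}32,3\text{-}12\}$; (20) $Q=\{1\text{-}23,12\text{-}3,3\text{-}21,1\text{-}32\}$, $r\in\{3\text{-}12,23\text{-}1\}$; (21) $Q=\{1\text{-}23,12\text{-}3,3\text{-}21,23\text{-}1\}$, $r\in\{2\text{-}31,32\text{-}1\}$; (22) $Q=\{1\text{-}23,2\text{-}13,3\text{-}21,31\text{-}2\}$, $r=3\text{-}12$; (23) $Q=\{1\text{-}23,23\text{-}1,32\text{-}1,13\text{-}2\}$, $r=2\text{-}31$; (24) $Q=\{1\text{-}23,2\text{-}13,32\text{-}1,3\text{-}12\}$, $r=1\text{-}32$; (25) $Q=\{1\text{-}23,21\text{-}3,3\text{-}21,13\text{-}2\}$, $r=3\text{-}12$; (26) $Q=\{1\text{-}23,21\text{-}3,32\text{-}1,3\text{-}12\}$, $r=23\text{-}1$.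
   Context: $S_n$ is the set of permutations $\pi=\pi_1\pi_2\cdots\pi_n$ of $\{1,\dots,n\}$. For $abc$ a permutation of $123$, the generalized pattern $a\text{-}bc$ is contained in $\pi$ if there are indices $i<j$ with $j+1\le n$ such that $\pi_i\pi_j\pi_{j+1}$ is order-isomorphic to $abc$; the generalized pattern $ab\text{-}c$ is contained in $\pi$ if there are indices $i,k$ with $i+1<k\le n$ such that $\pi_i\pi_{i+1}\pi_k$ is order-isomorphic to $abc$. (Letters not separated by a dash must occur in adjacent positions; letters separated by a dash need not be adjacent.) $\pi$ avoids a pattern if it does not contain it. For a set $T$ of generalized patterns, $S_n(T)$ is the set of $\pi\in S_n$ avoiding every pattern in $T$. *)

(* Defs.v *)
From HB Require Import structures.
From mathcomp Require Import all_boot all_fingroup.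

Set Implicit Arguments.
Unset Strict Implicit.
Unset Printing Implicit Defensive.

(* [Dash1 a b c] is the pattern a-bc and [Dash2 a b c] is the pattern ab-c. *)
Inductive gpattern : Type :=
  | Dash1 of nat & nat & nat
  | Dash2 of nat & nat & nat.

Definition gpattern_code (p : gpattern) : bool * (nat * nat * nat) :=
  match p with
  | Dash1 a b c => (false, (a, b, c))
  | Dash2 a b c => (true, (a, b, c))
  end.

Definition gpattern_decode (x : bool * (nat * nat * nat)) : gpattern :=
  let: (d, (a, b, c)) := x in if d then Dash2 a b c else Dash1 a b c.

Lemma gpattern_codeK : cancel gpattern_code gpattern_decode.
Proof. by case. Qed.

HB.instance Definition _ := Equality.copy gpattern (can_type gpattern_codeK).

Definition order_iso (u v : seq nat) : bool :=
  (size u == size v) &&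
  [forall i : 'I_(size u), forall j : 'I_(size u),
     (nth 0 u i < nth 0 u j) == (nth 0 v i < nth 0 v j)].

(* Positions and values are numbered from 0 in ['S_n]; both shifts from the
   convention {1, ..., n} are order-preserving and keep adjacency. *)
Definition contains (n : nat) (s : 'S_n) (p : gpattern) : bool :=
  match p with
  | Dash1 a b c =>
      [exists i : 'I_n, exists j : 'I_n, exists k : 'I_n,
        [&& i < j, k == j.+1 :> nat &
            order_iso [:: a; b; c] [:: val (s i); val (s j); val (s k)]]]
  | Dash2 a b c =>
      [exists i : 'I_n, exists j : 'I_n, exists k : 'I_n,
        [&& j == i.+1 :> nat, j < k &
            order_iso [:: a; b; c] [:: val (s i); val (s j); val (s k)]]]
  end.

Definition avoids (n : nat) (s : 'S_n) (p : gpattern) : bool := ~~ contains s p.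

Definition avoiders (n : nat) (T : seq gpattern) : {set 'S_n} :=
  [set s : 'S_n | all (avoids s) T].

(* The underscore stands for the dash. *)
Definition p1_23 := Dash1 1 2 3.
Definition p1_32 := Dash1 1 3 2.
Definition p2_13 := Dash1 2 1 3.
Definition p2_31 := Dash1 2 3 1.
Definition p3_12 := Dash1 3 1 2.
Definition p3_21 := Dash1 3 2 1.
Definition p12_3 := Dash2 1 2 3.
Definition p13_2 := Dash2 1 3 2.
Definition p21_3 := Dash2 2 1 3.
Definition p23_1 := Dash2 2 3 1.
Definition p31_2 := Dash2 3 1 2.
Definition p32_1 := Dash2 3 2 1.

(* Main.v *)
Require Import Defs.
From mathcomp Require Import all_boot all_fingroup.

(** Containment of a generalized pattern passes from a prefix of a permutation
    to the whole permutation, and depends only on the relative order of the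
    letters of that prefix. Hence if every permutation of length [k] contains a
    pattern of [T], so does every longer one. For each set [T] considered, one
    of [k = 4, 5, 6] works, which is a finite computation. *)

(* [order_iso] does not reduce, since [forallb] is locked; this variant does. *)
Definition order_isob (u v : seq nat) : bool :=
  (size u == size v) &&
  all (fun i => all (fun j =>
      (nth 0 u i < nth 0 u j) == (nth 0 v i < nth 0 v j))
    (iota 0 (size u))) (iota 0 (size u)).

Lemma order_isobE u v : order_iso u v = order_isob u v.
Proof.
congr (_ && _); apply/forallP/allP => [H i | H i].
  rewrite mem_iota => /= lt_iu; apply/allP => j; rewrite mem_iota => /= lt_ju.
  by have /forallP/(_ (Ordinal lt_ju)) := H (Ordinal lt_iu).
have in_u (m : 'I_(size u)) : val m \in iota 0 (size u) by rewrite mem_iota /=.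
by apply/forallP => j; apply: (allP (H _ (in_u i)) _ (in_u j)).
Qed.

(** A search over words that reduces, unlike [contains]. The bounds keep every position inside [w],
    so the default 0 of [nth] is never read: [j] stops before the last position, and [i < k.-1]
    leaves room for [i.+1] before [k]. *)
Definition word_contains (w : seq nat) (p : gpattern) : bool :=
  match p with
  | Dash1 a b c =>
      has (fun j => has (fun i =>
          order_isob [:: a; b; c] [:: nth 0 w i; nth 0 w j; nth 0 w j.+1])
        (iota 0 j)) (iota 0 (size w).-1)
  | Dash2 a b c =>
      has (fun k => has (fun i =>
          order_isob [:: a; b; c] [:: nth 0 w i; nth 0 w i.+1; nth 0 w k])
        (iota 0 k.-1)) (iota 0 (size w))
  end.

Lemma order_isob_map (f : nat -> nat) u v :
  {in v &, {mono f : x y / x < y}} ->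
  order_isob u (map f v) = order_isob u v.
Proof.
move=> f_mono; rewrite /order_isob size_map; case: eqP => //= size_uv.
apply: eq_in_all => i; rewrite mem_iota size_uv => /= lt_iv.
apply: eq_in_all => j; rewrite mem_iota => /= lt_jv.
by rewrite !(nth_map 0) // f_mono ?mem_nth.
Qed.

Lemma word_contains_map (f : nat -> nat) w p :
  {in w &, {mono f : x y / x < y}} ->
  word_contains (map f w) p = word_contains w p.
Proof.
move=> f_mono; have iso3 i j k v : i < size w -> j < size w -> k < size w ->
    order_isob v [:: nth 0 (map f w) i; nth 0 (map f w) j; nth 0 (map f w) k]
    = order_isob v [:: nth 0 w i; nth 0 w j; nth 0 w k].
  move=> lt_i lt_j lt_k; rewrite !(nth_map 0) //.
  rewrite -[RHS](@order_isob_map f) // => x y.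
  by rewrite !inE => /or3P[] /eqP-> /or3P[] /eqP->; apply: f_mono; apply: mem_nth.
case: p => a b c /=; rewrite size_map; apply: eq_in_has => j; rewrite mem_iota /=.
  move=> lt_j; apply: eq_in_has => i; rewrite mem_iota /= => lt_ij.
  have lt_j1 : j.+1 < size w by case: (size w) lt_j.
  by apply: iso3 => //; [apply: ltn_trans (ltnW lt_j1) | apply: ltnW].
move=> lt_j; apply: eq_in_has => i; rewrite mem_iota /= => lt_ij.
(* The bound [i < j.-1] rules out [j = 0], where the range of [i] is empty, so the truncated
   predecessor does no harm. *)
have lt_i1j : i.+1 < j by case: j lt_ij {lt_j}.
have lt_i1 := ltn_trans lt_i1j lt_j.
by apply: iso3 => //; apply: ltnW.
Qed.

Definition standardization (w : seq nat) : seq nat :=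
  [seq count (fun y => y < x) w | x <- w].

(** If [x < y], every letter below [x] is below [y], and [x] itself is counted for [y] but not for
    [x]: ranks increase strictly, which on a total order gives the equivalence. *)
Lemma count_lt_mono (w : seq nat) :
  {in w &, {mono (fun x => count (fun y => y < x) w) : x y / x < y}}.
Proof.
apply: leqW_mono_in; apply: leq_mono_in => x y w_x w_y lt_xy.
rewrite -[X in _ < X]size_filter -(count_predC (fun z => z < x)) !count_filter.
rewrite (eq_count (a2 := fun z => z < x)); last first.
  by move=> z /=; case: ltnP => //= lt_zx; rewrite (ltn_trans lt_zx).
rewrite -[X in X < _]addn0 ltn_add2l -has_count; apply/hasP; exists x => //=.
by rewrite ltnn.
Qed.

(** Strict monotonicity makes the ranks distinct, and each is less than [size w] because no letter
    lies below itself; by counting, they fill the whole interval. *)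
Lemma standardization_perm w :
  uniq w -> perm_eq (standardization w) (iota 0 (size w)).
Proof.
move=> w_uniq; have u_uniq : uniq (standardization w).
  rewrite map_inj_in_uniq // => x y w_x w_y eq_xy.
  have := count_lt_mono w x y w_x w_y; have := count_lt_mono w y x w_y w_x.
  by rewrite /= eq_xy ltnn; case: ltngtP.
have sub_u : {subset standardization w <= iota 0 (size w)}.
  move=> _ /mapP[x w_x ->]; rewrite mem_iota /= add0n ltn_neqAle count_size.
  by rewrite andbT -all_count; apply/allPn; exists x; rewrite ?ltnn.
have [|_ eq_u] := uniq_min_size u_uniq sub_u; first by rewrite size_iota size_map.
by apply: uniq_perm; rewrite ?iota_uniq.
Qed.

(** Positions of a prefix are positions of the whole word, with the same letters and the same
    adjacencies. *)
Lemma contains_prefix n (s : 'S_n) k p :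
  word_contains (take k [seq val (s i) | i <- enum 'I_n]) p -> contains s p.
Proof.
set w := map _ _; have size_w : size w = n by rewrite size_map size_enum_ord.
have nth_w (i : 'I_n) : nth 0 w i = s i.
  by rewrite (nth_map i) ?size_enum_ord ?nth_ord_enum.
have lt_take m : m < size (take k w) -> (m < k) && (m < n).
  by rewrite size_take_min leq_min size_w.
case: p => a b c /hasP[j]; rewrite mem_iota add0n /= => lt_j /hasP[i].
  rewrite mem_iota add0n /= => lt_ij.
  have /lt_take/andP[lt_j1k lt_j1n] : j.+1 < size (take k w).
    by case: (size (take k w)) lt_j.
  have [lt_jk lt_jn] := (ltnW lt_j1k, ltnW lt_j1n).
  have [lt_ik lt_in] := (ltn_trans lt_ij lt_jk, ltn_trans lt_ij lt_jn).
  rewrite !nth_take // -order_isobE => iso.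
  apply/existsP; exists (Ordinal lt_in); apply/existsP; exists (Ordinal lt_jn).
  apply/existsP; exists (Ordinal lt_j1n).
  by rewrite /= lt_ij eqxx -!nth_w.
rewrite mem_iota add0n /= => lt_ij.
have lt_i1j : i.+1 < j by case: j lt_ij {lt_j}.
have /lt_take/andP[lt_jk lt_jn] := lt_j.
have [lt_i1k lt_i1n] := (ltn_trans lt_i1j lt_jk, ltn_trans lt_i1j lt_jn).
have [lt_ik lt_in] := (ltnW lt_i1k, ltnW lt_i1n).
rewrite !nth_take // -order_isobE => iso.
apply/existsP; exists (Ordinal lt_in); apply/existsP; exists (Ordinal lt_i1n).
apply/existsP; exists (Ordinal lt_jn).
by rewrite /= lt_i1j eqxx -!nth_w.
Qed.

(** Ranges over a list of words instead of ['S_k], so that evaluation decides it. *)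
Definition unavoidable (k : nat) (T : seq gpattern) : bool :=
  all (fun w => has (word_contains w) T) (permutations (iota 0 k)).

Lemma avoiders_unavoidable k T n :
  unavoidable k T -> k <= n -> #|avoiders n T| = 0.
Proof.
move=> /allP unav le_kn; apply: eq_card0 => s; rewrite !inE.
set w := take k [seq val (s i) | i <- enum 'I_n].
have size_w : size w = k by rewrite size_takel // size_map size_enum_ord.
have uniq_w : uniq w.
  apply: take_uniq; rewrite map_inj_uniq ?enum_uniq //.
  by move=> i j /val_inj/perm_inj.
(* The letters of [w] are arbitrary values below [n], so [w] itself need not be among the enumerated
   words; its standardization is, and monotonicity of ranks carries the pattern back to [w]. *)
have /hasP[p T_p] : has (word_contains (standardization w)) T.
  by apply: unav; rewrite mem_permutations -size_w standardization_perm.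
rewrite word_contains_map; last exact: count_lt_mono.
move=> /contains_prefix s_p; apply/negbTE/allPn; exists p => //.
by rewrite negbK.
Qed.

(* Each pair (Q, R) stands for the sets T = Q + {r}, one for each r in R. *)
Theorem mainTheorem13 (Q R : seq gpattern) (r : gpattern) :
  (Q, R) \in [::
      ([:: p1_23; p2_13; p3_21; p12_3],
       [:: p21_3; p2_31; p23_1; p1_32; p13_2; p3_12; p31_2; p32_1]);
      ([:: p1_23; p2_13; p3_21; p21_3],
       [:: p2_31; p23_1; p1_32; p13_2; p3_12; p31_2]);
      ([:: p1_23; p2_13; p32_1; p12_3],
       [:: p21_3; p2_31; p23_1; p1_32; p3_12; p31_2]);
      ([:: p1_23; p2_13; p32_1; p21_3],
       [:: p2_31; p23_1; p1_32; p13_2; p3_12; p31_2]);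
      ([:: p1_23; p2_13; p3_21; p23_1],
       [:: p1_32; p13_2; p3_12; p31_2; p32_1]);
      ([:: p1_23; p2_13; p32_1; p2_31],
       [:: p23_1; p1_32; p13_2; p31_2; p3_12]);
      ([:: p1_23; p21_3; p3_21; p1_32],
       [:: p12_3; p32_1; p13_2; p3_12; p31_2]);
      ([:: p1_23; p21_3; p32_1; p2_31],
       [:: p3_12; p13_2; p1_32; p23_1; p12_3]);
      ([:: p1_23; p23_1; p32_1; p2_13],
       [:: p1_32; p13_2; p3_12; p31_2]);
      ([:: p1_23; p2_13; p3_21; p1_32],
       [:: p13_2; p3_12; p31_2]);
      ([:: p1_23; p23_1; p32_1; p12_3],
       [:: p1_32; p2_31; p31_2]);
      ([:: p1_23; p21_3; p3_21; p31_2],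
       [:: p12_3; p13_2; p3_12]);
      ([:: p1_23; p21_3; p3_21; p23_1],
       [:: p1_32; p13_2; p32_1]);
      ([:: p1_23; p21_3; p32_1; p13_2],
       [:: p3_21; p23_1; p1_32]);
      ([:: p1_23; p2_13; p3_21; p13_2],
       [:: p3_12; p31_2]);
      ([:: p1_23; p2_13; p3_21; p2_31],
       [:: p1_32; p13_2]);
      ([:: p1_23; p2_13; p3_21; p32_1],
       [:: p13_2; p3_12]);
      ([:: p1_23; p23_1; p32_1; p1_32],
       [:: p21_3; p13_2]);
      ([:: p1_23; p2_13; p32_1; p13_2],
       [:: p1_32; p3_12]);
      ([:: p1_23; p12_3; p3_21; p1_32],
       [:: p3_12; p23_1]);
      ([:: p1_23; p12_3; p3_21; p23_1],
       [:: p2_31; p32_1]);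
      ([:: p1_23; p2_13; p3_21; p31_2],
       [:: p3_12]);
      ([:: p1_23; p23_1; p32_1; p13_2],
       [:: p2_31]);
      ([:: p1_23; p2_13; p32_1; p3_12],
       [:: p1_32]);
      ([:: p1_23; p21_3; p3_21; p13_2],
       [:: p3_12]);
      ([:: p1_23; p21_3; p32_1; p3_12],
       [:: p23_1])] ->
  r \in R ->
  exists k : nat, forall n : nat, k <= n -> #|avoiders n (r :: Q)| = 0.
Proof.
move=> QR_in R_r; move: QR_in; set table := (X in _ \in X) => QR_in.
(* One evaluation tests the whole table; [has] lets each set pick its own length, with at most 6! =
   720 words to inspect per length. *)
have /allP/(_ _ QR_in)/allP/(_ _ R_r)/hasP[k _ unav] : all (fun QR =>
    all (fun x => has (unavoidable^~ (x :: QR.1)) [:: 4; 5; 6]) QR.2) table.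
  by vm_compute.
by exists k => n; apply: avoiders_unavoidable.
Qed.
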